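(* Let $A, B \in \mathbb{P}_m$ be $m\times m$ positive definite Hermitian matrices. For any $t \in [0,1]$, $$ s\left(A^{t-\frac12}\,(A \#_t B)\,B^{\frac12 - t}\right) \prec_{\log} s\left(A^{1/2}B^{1/2}\right). $$
   Context: $\mathbb{P}_m$ is the set of $m\times m$ complex positive definite Hermitian matrices; real powers are taken by functional calculus. For $A,B\in\mathbb{P}_m$ and $t\in\mathbb{R}$, the metric geometric mean is $A \#_t B = A^{1/2}(A^{-1/2}BA^{-1/2})^tA^{1/2}$. For an $m\times m$ complex matrix $X$, $s(X)=(s_1(X),\dots,s_m(X))$ is the tuple of singular values (eigenvalues of $(X^*X)^{1/2}$) in non-increasing order. For $m$-tuples $x,y$ of positive reals with non-increasing rearrangements $x^\downarrow,y^\downarrow$, $x\prec_{\log}y$ (log-majorization) means $\prod_{i=1}^k x_i^\downarrow\le\prod_{i=1}^k y_i^\downarrow$ for $k=1,\dots,m-1$, with equality for $k=m$. *)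

(* Defs.v *)
From mathcomp Require Import all_boot all_order all_algebra.
From mathcomp Require Import spectral sesquilinear.
From mathcomp Require Import complex.
From mathcomp Require Import reals exp.

Set Implicit Arguments.
Unset Strict Implicit.
Unset Printing Implicit Defensive.

Import Order.TTheory GRing.Theory Num.Theory.
Local Open Scope ring_scope.
Local Open Scope complex_scope.
Local Open Scope sesquilinear_scope.

(* In the order of R[i], 0 < z means that z is real and positive. *)
Definition posdefmx (R : realType) (m : nat) (A : 'M[R[i]]_m) : Prop :=
  A \is hermsymmx /\
  forall v : 'cV[R[i]]_m, v != 0 -> 0 < (v ^t* *m A *m v) 0 0.

(* With multiplicity, in no particular order; meaningful for Hermitian A,
   where spectral_diag A is the (real) diagonal of a unitary diagonalization. *)
Definition herm_eigenvalues (R : realType) (m : nat) (A : 'M[R[i]]_m) :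
    m.-tuple R :=
  [tuple complex.Re (spectral_diag A 0 j) | j < m].

(* Functional calculus for Hermitian A, using the decomposition
   A = invmx P *m diag_mx (spectral_diag A) *m P with P := spectralmx A unitary;
   the result does not depend on the choice of the diagonalization. *)
Definition herm_fun (R : realType) (f : R -> R) (m : nat) (A : 'M[R[i]]_m) :
    'M[R[i]]_m :=
  invmx (spectralmx A)
    *m diag_mx (\row_j (f (tnth (herm_eigenvalues A) j))%:C)
    *m spectralmx A.

(* powR (`^) is the usual real power on positive reals, and 0 `^ t = 0 for
   t != 0, so mxpow A 2^-1 is the square root of A also when A is singular. *)
Definition mxpow (R : realType) (m : nat) (A : 'M[R[i]]_m) (t : R) :
    'M[R[i]]_m :=
  herm_fun (fun x : R => x `^ t) A.

Definition geomean (R : realType) (m : nat) (t : R) (A B : 'M[R[i]]_m) :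
    'M[R[i]]_m :=
  mxpow A 2^-1
    *m mxpow (mxpow A (- 2^-1) *m B *m mxpow A (- 2^-1)) t
    *m mxpow A 2^-1.

Definition decr (R : realType) (m : nat) (x : m.-tuple R) : m.-tuple R :=
  [tuple of sort >=%R x].

Definition singular_values (R : realType) (m : nat) (X : 'M[R[i]]_m) :
    m.-tuple R :=
  decr (herm_eigenvalues (mxpow (X ^t* *m X) 2^-1)).

Definition log_majorized (R : realType) (m : nat) (x y : m.-tuple R) : Prop :=
  (forall k : nat, (1 <= k <= m.-1)%N ->
     \prod_(i < k) (decr x)`_i <= \prod_(i < k) (decr y)`_i) /\
  \prod_(i < m) (decr x)`_i = \prod_(i < m) (decr y)`_i.

(* Main.v *)
Require Import Defs.
From mathcomp Require Import all_boot all_order all_algebra.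
From mathcomp Require Import spectral sesquilinear.
From mathcomp Require Import complex.
From mathcomp Require Import boolp reals topology normedtype sequences exp.
From mathcomp Require Import perm fingroup.
From mathcomp Require Import ring lra.

(* Let X t be the matrix on the left and Y the one on the right.  The largest
   singular value: if |Y|^2 <= c then B <= c A^-1, and for t <= 1/2 the
   Loewner-Heinz inequality gives B^(1-2t) <= c^(1-2t) A^(2t-1) and
   A #_t B <= c^t A^(1-2t), whence X t (X t)^* <= c; the case t >= 1/2 follows
   from A #_t B = B #_(1-t) A.  Compound matrices are multiplicative
   (Cauchy-Binet), hence commute with powers and geometric means, and the largest
   singular value of the k-th compound is the product of the k largest ones; so
   the bound for compounds is the k-th inequality.  For k = m compare
   determinants. *)

Set Implicit Arguments.
Unset Strict Implicit.
Unset Printing Implicit Defensive.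

Import Order.TTheory GRing.Theory Num.Theory.
Import numFieldNormedType.Exports.
Local Open Scope ring_scope.
Local Open Scope complex_scope.
Local Open Scope sesquilinear_scope.

(** * Hermitian matrices and the Loewner order *)

Section Adjoint.
Context {R : realType}.
Local Notation C := R[i].

(** For t <= 1/2 and G = A #_t B, the product X X^* is A^(t-1/2) G B^(1-2t) G A^(t-1/2). Replacing
    the inner power of B by a power of A turns it into a multiple of K^2, with K = A^(t-1/2) G
    A^(t-1/2). Squaring is not monotone for the Loewner order, but the bound on G becomes the scalar
    bound K <= c^t, and scalar bounds may be squared. Splitting at 1/2 keeps the exponent 1 - 2t
    inside [0,1], the range of Loewner-Heinz. Loewner-Heinz is itself proved here: the exponents
    that preserve a given inequality A <= B include 0 and 1, are stable under midpoints and form a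
    closed set. In these estimates largest singular values are not handled as maxima. It is shown
    instead that every scalar c > 0 bounding Y^* Y also bounds X^* X, a form that passes unchanged
    to compounds. *)

Lemma adjmxM m n p (A : 'M[C]_(m, n)) (B : 'M[C]_(n, p)) :
  (A *m B)^t* = B^t* *m A^t*.
Proof. by rewrite trmx_mul map_mxM. Qed.

Lemma adjmxB m n (A B : 'M[C]_(m, n)) : (A - B)^t* = A^t* - B^t*.
Proof. by rewrite linearB /= map_mxB. Qed.

Lemma conjC_real (x : R) : (x%:C)^* = x%:C :> C.
Proof. exact: conjc_real. Qed.

Lemma adjmx_real_scalar n (c : R) : (c%:C%:M : 'M[C]_n)^t* = c%:C%:M.
Proof. by rewrite tr_scalar_mx map_scalar_mx; congr (_%:M); exact: conjC_real. Qed.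

Lemma adjmx_det n (A : 'M[C]_n) : \det (A^t*) = (\det A)^*.
Proof. by rewrite det_map_mx det_tr. Qed.

Lemma unitarymxVP n (U : 'M[C]_n) : U \is unitarymx -> U^t* *m U = 1%:M.
Proof. by move=> /unitarymxP /mulmx1C. Qed.

Lemma hermsymmxP n (A : 'M[C]_n) : reflect (A^t* = A) (A \is hermsymmx).
Proof.
apply: (iffP (is_hermitianmxP _ _ _)); rewrite expr0 scale1r; first by move<-.
by move->.
Qed.

End Adjoint.

Section QuadraticForm.
Context {R : realType}.
Local Notation C := R[i].

Definition qform n (A : 'M[C]_n) (v : 'cV[C]_n) : C := (v^t* *m A *m v) 0 0.

(** In [R[i]] the relation [<=] forces the difference to be real, so this makes B - A Hermitian as
    well as positive semidefinite. *)
Definition lemx n (A B : 'M[C]_n) := forall v, qform A v <= qform B v.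

Lemma qform_congr m n (X : 'M[C]_(m, n)) (A : 'M[C]_m) v :
  qform (X^t* *m A *m X) v = qform A (X *m v).
Proof. by rewrite /qform adjmxM !mulmxA. Qed.

Lemma qformD n (A B : 'M[C]_n) v : qform (A + B) v = qform A v + qform B v.
Proof. by rewrite /qform mulmxDr mulmxDl mxE. Qed.

Lemma qformN n (A : 'M[C]_n) v : qform (- A) v = - qform A v.
Proof. by rewrite /qform mulmxN mulNmx mxE. Qed.

Lemma qformB n (A B : 'M[C]_n) v : qform (A - B) v = qform A v - qform B v.
Proof. by rewrite qformD qformN. Qed.

Lemma qformZ n c (A : 'M[C]_n) v : qform (c *: A) v = c * qform A v.
Proof. by rewrite /qform -scalemxAr -scalemxAl mxE. Qed.

Lemma qform_diag n (d : 'I_n -> C) v :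
  qform (diag_mx (\row_j d j)) v = \sum_j d j * `|v j 0| ^+ 2.
Proof.
rewrite /qform mxE; apply: eq_bigr => j _.
by rewrite mul_mx_diag !mxE normCK [_ * d j]mulrC -mulrA [X in d j * X]mulrC.
Qed.

Lemma qform1 n (v : 'cV[C]_n) : qform 1%:M v = \sum_j `|v j 0| ^+ 2.
Proof.
have -> : 1%:M = diag_mx (\row_(j < n) (1 : C)) :> 'M[C]_n.
  by apply/matrixP => i j; rewrite !mxE.
by rewrite qform_diag; apply: eq_bigr => j _; rewrite mul1r.
Qed.

Lemma qform1_gt0 n (v : 'cV[C]_n) : (0 < qform 1%:M v) = (v != 0).
Proof.
have ge0 j : true -> 0 <= `|v j 0| ^+ 2 by rewrite exprn_ge0.
rewrite qform1 lt_def sumr_ge0 ?andbT; last by move=> j /ge0.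
congr (~~ _); apply/eqP/eqP => [/(psumr_eq0P ge0) v0|->].
  apply/matrixP => j k; rewrite ord1 !mxE.
  by have /eqP := v0 j isT; rewrite sqrf_eq0 normr_eq0 => /eqP.
by rewrite big1 // => j _; rewrite mxE normr0 expr0n.
Qed.

Lemma qform1_ge0 n (v : 'cV[C]_n) : 0 <= qform 1%:M v.
Proof. by rewrite qform1 sumr_ge0 // => j _; rewrite exprn_ge0. Qed.

Lemma lemx_trans n (B A D : 'M[C]_n) : lemx A B -> lemx B D -> lemx A D.
Proof. by move=> AB BD v; apply: le_trans (AB v) (BD v). Qed.

Lemma lemx_congr m n (X : 'M[C]_(m, n)) (A B : 'M[C]_m) :
  lemx A B -> lemx (X^t* *m A *m X) (X^t* *m B *m X).
Proof. by move=> AB v; rewrite !qform_congr. Qed.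

Lemma lemxZ n (c : R) (A B : 'M[C]_n) : 0 <= c ->
  lemx A B -> lemx (c%:C *: A) (c%:C *: B).
Proof. by move=> c0 AB v; rewrite !qformZ ler_wpM2l // lecR. Qed.

(* If X^t* X <= c and D := c - X X^t*, then c D - D^t* D = X (c - X^t* X) X^t*,
   so D is nonnegative. *)
Lemma lemx_gram_flip m n (X : 'M[C]_(m, n)) (c : R) : 0 < c ->
  lemx (X^t* *m X) c%:C%:M -> lemx (X *m X^t*) c%:C%:M.
Proof.
move=> c0 Xc v; set D : 'M[C]_m := c%:C%:M - X *m X^t*.
have DE : D^t* = D by rewrite /D adjmxB adjmx_real_scalar adjmxM trmxCK.
have key : c%:C *: D - D^t* *m 1%:M *m D
   = X^t*^t* *m (c%:C%:M - X^t* *m X) *m X^t*.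
  rewrite DE mulmx1 trmxCK {2}/D mulmxBl mul_scalar_mx opprB addrC subrK.
  rewrite {1}/D !mulmxBr !mulmxBl !mulmxA.
  by congr (_ - _); rewrite mul_mx_scalar mul_mx_scalar scalemxAl.
have : 0 <= c%:C * qform D v.
  have := congr1 (fun M => qform M v) key.
  rewrite qformB !qform_congr qformZ [qform (_ - X^t* *m X) _]qformB => /eqP.
  rewrite subr_eq => /eqP ->.
  by rewrite addr_ge0 ?qform1_ge0 // subr_ge0.
by rewrite pmulr_rge0; [rewrite qformB subr_ge0|rewrite (ltcR 0)].
Qed.

End QuadraticForm.

(** * Unitary diagonalization and functional calculus *)

Section SpectralForm.
Context {R : realType}.
Local Notation C := R[i].

Definition rdiag n (d : 'I_n -> R) : 'M[C]_n := diag_mx (\row_j (d j)%:C).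

(** The unitary is arbitrary, not [spectralmx]: powers and compounds inherit a diagonalization from
    their argument, and it need not be the one that [spectralmx] selects. *)
Definition specmx n (U : 'M[C]_n) (d : 'I_n -> R) : 'M[C]_n :=
  U^t* *m rdiag d *m U.

Lemma eq_rdiag n (d e : 'I_n -> R) : d =1 e -> rdiag d = rdiag e.
Proof. by move=> /funext ->. Qed.

Lemma eq_specmx n (U : 'M[C]_n) (d e : 'I_n -> R) :
  d =1 e -> specmx U d = specmx U e.
Proof. by move=> /eq_rdiag de; rewrite /specmx de. Qed.

Lemma adjmx_rdiag n (d : 'I_n -> R) : (rdiag d)^t* = rdiag d.
Proof.
rewrite /rdiag tr_diag_mx map_diag_mx; congr diag_mx.
by apply/rowP => j; rewrite !mxE; exact: conjC_real.
Qed.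

Lemma rdiagM n (d e : 'I_n -> R) :
  rdiag d *m rdiag e = rdiag (fun j => d j * e j).
Proof.
rewrite /rdiag mulmx_diag; congr diag_mx.
by apply/rowP => j; rewrite !mxE rmorphM.
Qed.

Lemma rdiag_const n (c : R) : rdiag (fun _ : 'I_n => c) = c%:C%:M.
Proof.
by rewrite /rdiag -diag_const_mx; congr diag_mx; apply/rowP => j; rewrite !mxE.
Qed.

Lemma adjmx_specmx n (U : 'M[C]_n) d : (specmx U d)^t* = specmx U d.
Proof. by rewrite /specmx !adjmxM adjmx_rdiag trmxCK mulmxA. Qed.

Lemma specmxM n (U : 'M[C]_n) d e : U \is unitarymx ->
  specmx U d *m specmx U e = specmx U (fun j => d j * e j).
Proof.
move=> Uu; rewrite /specmx -(rdiagM d e) !mulmxA.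
by rewrite -[_ *m U *m U^t*]mulmxA (unitarymxP Uu) mulmx1.
Qed.

Lemma specmx_const n (U : 'M[C]_n) c : U \is unitarymx ->
  specmx U (fun=> c) = c%:C%:M.
Proof.
move=> Uu; rewrite /specmx rdiag_const mul_mx_scalar -scalemxAl.
by rewrite unitarymxVP // scalemx1.
Qed.

Lemma specmxZ n (U : 'M[C]_n) c d :
  c%:C *: specmx U d = specmx U (fun j => c * d j).
Proof.
have DE : rdiag (fun j => c * d j) = c%:C *: rdiag d.
  by apply/matrixP => i j; rewrite !mxE rmorphM mulrnAr.
by rewrite /specmx DE -scalemxAr -scalemxAl.
Qed.

Lemma qform_specmx n (U : 'M[C]_n) d v :
  qform (specmx U d) v = \sum_j (d j)%:C * `|(U *m v) j 0| ^+ 2.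
Proof. by rewrite qform_congr qform_diag. Qed.

Lemma qform_specmx_basis n (U : 'M[C]_n) d j : U \is unitarymx ->
  qform (specmx U d) (U^t* *m delta_mx j 0) = (d j)%:C.
Proof.
move=> Uu; rewrite qform_specmx mulmxA (unitarymxP Uu) mul1mx.
rewrite (bigD1 j) //= big1 => [|k kj]; last first.
  by rewrite mxE (negPf kj) normr0 expr0n mulr0.
by rewrite mxE !eqxx normr1 expr1n mulr1 addr0.
Qed.

Lemma det_specmx n (U : 'M[C]_n) d : U \is unitarymx ->
  \det (specmx U d) = (\prod_j d j)%:C.
Proof.
move=> Uu; rewrite /specmx !det_mulmx mulrAC -det_mulmx unitarymxVP // det1 mul1r.
by rewrite det_diag rmorph_prod; apply: eq_bigr => j _; rewrite mxE.
Qed.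

(** The bridge from the Loewner order to eigenvalues: the columns of [U^t*] are eigenvectors, and
    testing the form on them isolates each [d j]. *)
Lemma lemx_specmxP n (U : 'M[C]_n) d c : U \is unitarymx ->
  lemx (specmx U d) c%:C%:M <-> forall j, d j <= c.
Proof.
move=> Uu; rewrite -(specmx_const c Uu); split=> [le_dc j|le_dc v]; last first.
  rewrite !qform_specmx ler_sum // => j _.
  by rewrite ler_wpM2r ?exprn_ge0 // lecR.
by have := le_dc (U^t* *m delta_mx j 0); rewrite !qform_specmx_basis // lecR.
Qed.

(* D W = W E with D, E diagonal means d_i w_ij = w_ij e_j, so f(D) W = W f(E). *)
Lemma specmx_intertwine m n (U : 'M[C]_m) (V : 'M[C]_n) d e (Z : 'M[C]_(m, n))
    (f : R -> R) : U \is unitarymx -> V \is unitarymx ->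
  specmx U d *m Z = Z *m specmx V e ->
  specmx U (f \o d) *m Z = Z *m specmx V (f \o e).
Proof.
move=> Uu Vu ZE; pose W := U *m Z *m V^t*.
have WE : rdiag d *m W = W *m rdiag e.
  have := congr1 (fun M => U *m M *m V^t*) ZE; rewrite /specmx /W !mulmxA.
  by rewrite (unitarymxP Uu) mul1mx mulmxtVK // => ->; rewrite !mulmxA.
have ZW : Z = U^t* *m W *m V.
  by rewrite /W !mulmxA unitarymxVP // mul1mx -mulmxA unitarymxVP // mulmx1.
clearbody W.
have fWE : rdiag (f \o d) *m W = W *m rdiag (f \o e).
  apply/matrixP => i j; have /matrixP/(_ i j) := WE.
  rewrite !mul_diag_mx !mul_mx_diag !mxE mulrC; have [->|w0] := eqVneq (W i j) 0.
    by rewrite !(mulr0, mul0r).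
  by move=> /(mulfI w0) /complexI /= ->; rewrite mulrC.
rewrite ZW /specmx !mulmxA (mulmxtVK _ Uu); rewrite -[_ *m _ *m W]mulmxA fWE.
by rewrite !mulmxA (mulmxtVK _ Vu).
Qed.

(** Intertwining by the identity matrix. It makes functional calculus independent of the
    diagonalization. *)
Lemma specmx_inj m (U V : 'M[C]_m) d e (f : R -> R) :
  U \is unitarymx -> V \is unitarymx ->
  specmx U d = specmx V e -> specmx U (f \o d) = specmx V (f \o e).
Proof.
move=> Uu Vu UV; have := @specmx_intertwine _ _ U V d e 1%:M f Uu Vu.
by rewrite !mulmx1 !mul1mx; apply.
Qed.

Lemma specmx_hermsymmx n (U : 'M[C]_n) d : specmx U d \is hermsymmx.
Proof. by apply/hermsymmxP; rewrite adjmx_specmx. Qed.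

Definition eigenval n (A : 'M[C]_n) (j : 'I_n) : R := tnth (herm_eigenvalues A) j.

Lemma herm_specmxE n (A : 'M[C]_n) : A \is hermsymmx ->
  A = specmx (spectralmx A) (eigenval A).
Proof.
move=> hA; have /orthomx_spectralP AE := hermitian_normalmx hA.
rewrite /specmx -(invmx_unitary (spectral_unitarymx A)) [LHS]AE.
suff -> : spectral_diag A = \row_j (eigenval A j)%:C by [].
apply/rowP => j; rewrite mxE /eigenval tnth_mktuple.
have /mxOverP/(_ 0 j) := hermitian_spectral_diag_real hA.
by case: (spectral_diag A 0 j) => a b; rewrite complex_real => /eqP ->.
Qed.

Lemma herm_fun_specmx n (U : 'M[C]_n) d f : U \is unitarymx ->
  herm_fun f (specmx U d) = specmx U (f \o d).
Proof.
move=> Uu; set A := specmx U d.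
have hA : A \is hermsymmx by exact: specmx_hermsymmx.
transitivity (specmx (spectralmx A) (f \o eigenval A)).
  by rewrite /herm_fun (invmx_unitary (spectral_unitarymx A)).
by apply: specmx_inj; rewrite ?spectral_unitarymx // -herm_specmxE.
Qed.

Lemma posdef_specmx n (U : 'M[C]_n) d : U \is unitarymx ->
  (forall j, 0 < d j) -> posdefmx (specmx U d).
Proof.
move=> Uu d0; split; first exact: specmx_hermsymmx.
move=> v v0; rewrite -/(qform _ v) qform_specmx.
have Uv0 : U *m v != 0.
  apply: contraNneq v0 => Uv.
  by rewrite -[v]mul1mx -(unitarymxVP Uu) -mulmxA Uv mulmx0.
have ge0 j : true -> 0 <= (d j)%:C * `|(U *m v) j 0| ^+ 2.
  by move=> _; rewrite mulr_ge0 ?exprn_ge0 // (lecR 0) ltW.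
rewrite lt_def sumr_ge0 ?andbT //; apply: contraNneq Uv0 => /(psumr_eq0P ge0) v0'.
apply/eqP/matrixP => j k; rewrite ord1 [RHS]mxE.
have /eqP := v0' j isT; rewrite mulf_eq0 sqrf_eq0 normr_eq0 => /orP[|/eqP //].
by move=> /eqP /(@complexI _ _ 0) dj; have := d0 j; rewrite dj ltxx.
Qed.

Lemma posdef_specP n (A : 'M[C]_n) : posdefmx A ->
  exists U d, [/\ U \is unitarymx, forall j, 0 < d j & A = specmx U d].
Proof.
move=> [hA Apos]; exists (spectralmx A), (eigenval A).
have Uu := spectral_unitarymx A; split; rewrite -?herm_specmxE // => j.
have := Apos (invmx (spectralmx A) *m delta_mx j 0).
rewrite invmx_unitary // -/(qform _ _) {2}(herm_specmxE hA).
rewrite qform_specmx_basis // (ltcR 0); apply.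
apply/eqP => /(congr1 (mulmx (spectralmx A))).
rewrite mulmxA (unitarymxP Uu) mul1mx mulmx0 => /matrixP/(_ j 0) /eqP.
by rewrite !mxE !eqxx oner_eq0.
Qed.

End SpectralForm.

(** * Real powers and the Loewner-Heinz inequality *)

Section RealPower.
Context {R : realType}.
Local Notation C := R[i].

(* An opaque copy of mxpow, which unification would unfold to a product. *)
Fact rpow_subproof :
  {P : forall n, 'M[C]_n -> R -> 'M[C]_n | forall n A t, P n A t = mxpow A t}.
Proof. by exists (@mxpow R). Qed.

Definition rpow n (A : 'M[C]_n) (t : R) : 'M[C]_n := sval rpow_subproof n A t.

Lemma rpowE n (A : 'M[C]_n) t : mxpow A t = rpow A t.
Proof. by rewrite /rpow (svalP rpow_subproof). Qed.

Lemma rpow_specmx n (U : 'M[C]_n) d t : U \is unitarymx ->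
  rpow (specmx U d) t = specmx U (fun j => d j `^ t).
Proof. by move=> Uu; rewrite -rpowE; exact: herm_fun_specmx. Qed.

#[local] Opaque powR.

Lemma posdef_rpow n (A : 'M[C]_n) t : posdefmx A -> posdefmx (rpow A t).
Proof.
move=> /posdef_specP [U [d [Uu d0 ->]]]; rewrite (rpow_specmx _ _ Uu).
by apply: posdef_specmx => // j; rewrite powR_gt0.
Qed.

Lemma posdef_adj n (A : 'M[C]_n) : posdefmx A -> A^t* = A.
Proof. by case=> /hermsymmxP. Qed.

Lemma adjmx_rpow n (A : 'M[C]_n) t : posdefmx A -> (rpow A t)^t* = rpow A t.
Proof. by move=> /(posdef_rpow t) /posdef_adj. Qed.

(** The sum is a separate variable so that a rewrite can prescribe the resulting exponent and leave
    the equation to [lra]. *)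
Lemma rpowD n (A : 'M[C]_n) s t u : posdefmx A -> s + t = u ->
  rpow A s *m rpow A t = rpow A u.
Proof.
move=> /posdef_specP [U [d [Uu d0 ->]]] <-.
rewrite !(rpow_specmx _ _ Uu) (specmxM _ _ Uu).
by apply: eq_specmx => j; rewrite powRD // (gt_eqF (d0 j)) implybT.
Qed.

Lemma mulmx_rpowD m n (X : 'M[C]_(m, n)) (A : 'M[C]_n) s t u :
  posdefmx A -> s + t = u -> X *m rpow A s *m rpow A t = X *m rpow A u.
Proof. by move=> hA stu; rewrite -mulmxA (rpowD hA stu). Qed.

Lemma rpow0 n (A : 'M[C]_n) : posdefmx A -> rpow A 0 = 1%:M.
Proof.
move=> /posdef_specP [U [d [Uu d0 ->]]]; rewrite (rpow_specmx _ _ Uu).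
rewrite -[1%:M](specmx_const 1 Uu).
by apply: eq_specmx => j; rewrite powRr0.
Qed.

Lemma rpow1 n (A : 'M[C]_n) : posdefmx A -> rpow A 1 = A.
Proof.
move=> /posdef_specP [U [d [Uu d0 ->]]]; rewrite (rpow_specmx _ _ Uu).
by apply: eq_specmx => j; rewrite powRr1 // ltW.
Qed.

Lemma rpowV n (A : 'M[C]_n) t : posdefmx A ->
  rpow A t *m rpow A (- t) = 1%:M.
Proof. by move=> hA; rewrite (@rpowD _ _ _ _ 0) ?subrr ?rpow0. Qed.

Lemma rpow_unit n (A : 'M[C]_n) t : posdefmx A -> rpow A t \in unitmx.
Proof. by move=> hA; have [tA _] := mulmx1_unit (rpowV t hA); exact: tA. Qed.

Lemma rpowM n (A : 'M[C]_n) s t : posdefmx A ->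
  rpow (rpow A s) t = rpow A (s * t).
Proof.
move=> /posdef_specP [U [d [Uu d0 ->]]]; rewrite !(rpow_specmx _ _ Uu).
by apply: eq_specmx => j; rewrite powRrM.
Qed.

Lemma rpowZ n (A : 'M[C]_n) c t : posdefmx A -> 0 < c ->
  rpow (c%:C *: A) t = (c `^ t)%:C *: rpow A t.
Proof.
move=> /posdef_specP [U [d [Uu d0 ->]]] c0; rewrite specmxZ !(rpow_specmx _ _ Uu).
by rewrite specmxZ; apply: eq_specmx => j; rewrite powRM // ltW.
Qed.

Lemma posdefZ n (A : 'M[C]_n) c : posdefmx A -> 0 < c -> posdefmx (c%:C *: A).
Proof.
move=> /posdef_specP [U [d [Uu d0 ->]]] c0; rewrite specmxZ.
by apply: posdef_specmx => // j; rewrite mulr_gt0.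
Qed.

Lemma posdef_congr n (X B : 'M[C]_n) : posdefmx B -> X \in unitmx ->
  posdefmx (X^t* *m B *m X).
Proof.
move=> [/hermsymmxP BE Bpos] Xu; split.
  by apply/hermsymmxP; rewrite !adjmxM trmxCK BE mulmxA.
move=> v v0; rewrite -/(qform _ v) qform_congr; apply: Bpos.
by apply: contraNneq v0 => Xv; rewrite -[v](mulKmx Xu) Xv mulmx0.
Qed.

Lemma rpow_intertwine n (A B Z : 'M[C]_n) t : posdefmx A -> posdefmx B ->
  A *m Z = Z *m B -> rpow A t *m Z = Z *m rpow B t.
Proof.
move=> /posdef_specP [U [d [Uu _ ->]]] /posdef_specP [V [e [Vu _ ->]]] ZE.
rewrite (rpow_specmx _ _ Uu) (rpow_specmx _ _ Vu).
exact: (specmx_intertwine (fun x => x `^ t) Uu Vu ZE).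
Qed.

Lemma powR_prod I (r : seq I) (P : pred I) (F : I -> R) t :
  (forall i, P i -> 0 <= F i) ->
  (\prod_(i <- r | P i) F i) `^ t = \prod_(i <- r | P i) F i `^ t.
Proof.
move=> F0; elim: r => [|x r IHr]; first by rewrite !big_nil powR1.
rewrite !big_cons; case: ifP => // Px.
by rewrite powRM ?F0 ?prodr_ge0 // IHr.
Qed.

Lemma det_rpow n (A : 'M[C]_n) t : posdefmx A ->
  \det (rpow A t) = (complex.Re (\det A) `^ t)%:C.
Proof.
move=> /posdef_specP [U [d [Uu d0 ->]]].
rewrite (rpow_specmx _ _ Uu) !(det_specmx _ Uu) /=.
by rewrite powR_prod // => j _; rewrite ltW.
Qed.

End RealPower.

Section LoewnerHeinz.
Context {R : realType}.
Local Notation C := R[i].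

(* A contraction similar to H has the eigenvalues of H, so these are at most 1. *)
Lemma lemx_similar_contraction n (H M G : 'M[C]_n) : H \is hermsymmx ->
  G \in unitmx -> lemx (M^t* *m M) 1%:M -> H *m G = G *m M -> lemx H 1%:M.
Proof.
move=> hH Gu Mc HG; rewrite (herm_specmxE hH).
have Uu := spectral_unitarymx H.
apply/(lemx_specmxP _ 1 Uu) => j; set a := eigenval H j.
pose v := (spectralmx H)^t* *m delta_mx j 0 : 'cV[C]_n.
have Hv : H *m v = a%:C *: v.
  rewrite {1}(herm_specmxE hH) /specmx /v !mulmxA mulmxtVK //.
  rewrite -[_ *m rdiag _ *m _]mulmxA.
  rewrite [rdiag _ *m delta_mx j 0](_ : _ = a%:C *: delta_mx j 0).
    by rewrite -scalemxAr.
  apply/matrixP => k l; rewrite mul_diag_mx !mxE.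
  by case: eqVneq => [->|]; rewrite ?mulr0.
pose w := invmx G *m v.
have Mw : M *m w = a%:C *: w.
  have MG : M *m invmx G = invmx G *m H.
    by rewrite -[LHS](mulKmx Gu) (mulmxA G) -HG (mulmxK Gu).
  rewrite /w (mulmxA M) MG -(mulmxA _ H) Hv; exact/esym/scalemxAr.
have v0 : v != 0.
  apply/eqP => /(congr1 (mulmx (spectralmx H))).
  rewrite mulmxA (unitarymxP Uu) mul1mx mulmx0 => /matrixP/(_ j 0) /eqP.
  by rewrite !mxE !eqxx oner_eq0.
have w0 : w != 0.
  by apply: contraNneq v0 => w0; rewrite -[v](mulKVmx Gu) -/w w0 mulmx0.
have := Mc w; rewrite -[M^t*]mulmx1 qform_congr Mw !qform1.
under eq_bigr do rewrite mxE normrM exprMn.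
rewrite -mulr_sumr -qform1 ger_pMl ?qform1_gt0 //.
have -> : `|a%:C| ^+ 2 = (a ^+ 2)%:C by rewrite -add_Re2_Im2 /= expr0n addr0.
by rewrite (lecR _ 1) => a1; nra.
Qed.

(** A^r <= B^r means that N_r = A^(r/2) B^(-r/2) is a contraction. The product M of the adjoint of
    N_t with N_s is then a contraction too, equal to B^(-t/2) A^p B^(-s/2). It is similar to the
    Hermitian H = B^(-p/2) A^p B^(-p/2), so H <= 1, which is the claim after conjugation. *)
Lemma lemx_rpow_midpoint n (A B : 'M[C]_n) s t : posdefmx A -> posdefmx B ->
  lemx (rpow A s) (rpow B s) -> lemx (rpow A t) (rpow B t) ->
  lemx (rpow A ((s + t) / 2)) (rpow B ((s + t) / 2)).
Proof.
move=> hA hB les let_; set p := (s + t) / 2.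
have adjA r := adjmx_rpow r hA; have adjB r := adjmx_rpow r hB.
pose N r := rpow A (r / 2) *m rpow B (- (r / 2)).
have NE r : (N r)^t* = rpow B (- (r / 2)) *m rpow A (r / 2).
  by rewrite /N adjmxM adjA adjB.
have Nc r : lemx (rpow A r) (rpow B r) -> lemx ((N r)^t* *m N r) 1%:M.
  move=> leAB; have := lemx_congr (rpow B (- (r / 2))) leAB; rewrite adjB.
  rewrite (rpowD (u := r / 2) hB); last by lra.
  rewrite (rpowV _ hB) NE /N mulmxA (mulmx_rpowD _ (u := r) hA); last by lra.
  exact.
(* In [M^t* *m M] the factor [N t] stands to the left of its adjoint, hence the flip. *)
have Ntc : lemx (N t *m (N t)^t*) 1%:M.
  exact: (lemx_gram_flip (c := 1) ltr01 (Nc _ let_)).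
pose M := (N t)^t* *m N s.
have Mc : lemx (M^t* *m M) 1%:M.
  have MN := lemx_congr (N s) Ntc; apply: lemx_trans (Nc _ les).
  by move: MN; rewrite mulmx1 /M (adjmxM ((N t)^t*) (N s)) trmxCK !mulmxA.
have ME : M = rpow B (- (t / 2)) *m rpow A p *m rpow B (- (s / 2)).
  rewrite /M NE /N mulmxA (mulmx_rpowD _ (u := p) hA) //.
  by rewrite /p; lra.
pose H := rpow B (- (p / 2)) *m rpow A p *m rpow B (- (p / 2)).
have hH : H \is hermsymmx.
  by apply/hermsymmxP; rewrite /H !adjmxM adjA adjB mulmxA.
have Hc : lemx H 1%:M.
  (* The power (t - s)/4 of B balances the outer exponents: -t/2 + (t - s)/4 = -p/2 = -s/2 - (t -
     s)/4. *)
  apply: (lemx_similar_contraction hH (rpow_unit ((t - s) / 4) hB) Mc).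
  rewrite /H ME (mulmx_rpowD _ (u := - (s / 2)) hB); last by rewrite /p; lra.
  rewrite !mulmxA (rpowD (u := - (p / 2)) hB); last by rewrite /p; lra.
  by [].
have := lemx_congr (rpow B (p / 2)) Hc; rewrite adjB mulmx1.
rewrite (rpowD (u := p) hB); last by lra.
rewrite /H !mulmxA (rpowV _ hB) mul1mx (mulmx_rpowD _ (u := 0) hB); last by lra.
by rewrite (rpow0 hB) mulmx1.
Qed.

(** Bisection encloses p between two points of P at distance 2^-k, whereas a failure at p would
    spread to a whole neighbourhood. *)
Lemma dyadic_closure (P : R -> Prop) : P 0 -> P 1 ->
  (forall s t, P s -> P t -> P ((s + t) / 2)) ->
  (forall p, ~ P p -> exists2 e, 0 < e & forall q, `|q - p| < e -> ~ P q) ->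
  forall p, 0 <= p <= 1 -> P p.
Proof.
move=> P0 P1 Pmid Popen p /andP[p0 p1].
have bisect k : exists a b, [/\ P a, P b, a <= p, p <= b & b - a = (2 ^+ k)^-1].
  elim: k => [|k [a [b [Pa Pb ap pb ab]]]].
    by exists 0, 1; rewrite subr0 expr0 invr1.
  have abS : (2 ^+ k.+1)^-1 = (b - a) / 2 by rewrite exprS invfM mulrC ab.
  have [pm|/ltW mp] := leP p ((a + b) / 2).
    by exists a, ((a + b) / 2); split=> //; [exact: Pmid|rewrite abS; lra].
  by exists ((a + b) / 2), b; split=> //; [exact: Pmid|rewrite abS; lra].
apply: contrapT => /Popen [e e0 nP].
(* [Num.bound e^-1] is an exponent k with 2^k > 1/e, so the enclosing interval is shorter than e. *)
have [a [b [Pa _ ap pb ab]]] := bisect (Num.bound e^-1).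
apply: (nP a) => //; rewrite distrC ger0_norm ?subr_ge0 //.
apply: le_lt_trans (_ : b - a < e); first by rewrite lerB.
by rewrite ab invf_plt ?posrE ?exprn_gt0 // upper_nthrootP.
Qed.

End LoewnerHeinz.

Section LoewnerHeinzTheorem.
Context {R : realType}.
Local Notation C := R[i].

Lemma continuous_powR_sum n (d c : 'I_n -> R) : (forall j, 0 < d j) ->
  continuous (fun q : R => \sum_j d j `^ q * c j).
Proof.
move=> d0; elim: (index_enum _) => [|j r IHr].
  by under eq_fun do rewrite big_nil; move=> p; exact: cvg_cst.
under eq_fun do rewrite big_cons.
move=> p; apply: cvgD; last exact: IHr.
apply: cvgM; last exact: cvg_cst.
have -> : powR (d j) = expR \o (fun q => q * ln (d j)).
  by apply/funext => q; rewrite /powR gt_eqF.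
apply: continuous_comp; last exact: continuous_expR.
by apply: continuousM; [exact: cvg_id|exact: cvg_cst].
Qed.

(** Exhibits the form as an embedded real function of the exponent, so that continuity can be argued
    over [R]. *)
Lemma qform_rpow_specmx n (U : 'M[C]_n) d q v : U \is unitarymx ->
  qform (rpow (specmx U d) q) v =
  (\sum_j d j `^ q *
     (complex.Re ((U *m v) j 0) ^+ 2 + complex.Im ((U *m v) j 0) ^+ 2))%:C.
Proof.
move=> Uu; rewrite rpow_specmx // qform_specmx rmorph_sum /=.
by apply: eq_bigr => j _; rewrite rmorphM /= add_Re2_Im2.
Qed.

(** A vector that violates the inequality at p violates it strictly, and by continuity the same
    vector does so for nearby exponents. *)
Lemma Nlemx_rpow_open n (A B : 'M[C]_n) p : posdefmx A -> posdefmx B ->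
  ~ lemx (rpow A p) (rpow B p) ->
  exists2 e, 0 < e &
    forall q, `|q - p| < e -> ~ lemx (rpow A q) (rpow B q).
Proof.
move=> /posdef_specP [U [d [Uu d0 ->]]] /posdef_specP [V [e [Vu e0 ->]]].
move=> /existsNP [v].
rewrite (qform_rpow_specmx _ _ _ Uu) (qform_rpow_specmx _ _ _ Vu) lecR => /negP.
pose a j := complex.Re ((U *m v) j 0) ^+ 2 + complex.Im ((U *m v) j 0) ^+ 2.
pose b j := complex.Re ((V *m v) j 0) ^+ 2 + complex.Im ((V *m v) j 0) ^+ 2.
rewrite -ltNge => lt_ba.
have : {for p, continuous (fun q : R =>
    \sum_j e j `^ q * b j - \sum_j d j `^ q * a j)}.
  by apply: continuousB; exact: continuous_powR_sum.
move=> /cvgr_lt /(_ 0); rewrite subr_lt0 => /(_ lt_ba).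
move=> /nbhs_ballP [r r0 rP]; exists r => // q qp /(_ v).
rewrite (qform_rpow_specmx _ _ _ Uu) (qform_rpow_specmx _ _ _ Vu) lecR.
rewrite leNgt -subr_lt0 => /negP; apply.
by apply: rP; rewrite /ball /= distrC.
Qed.

Theorem Loewner_Heinz n (A B : 'M[C]_n) p : posdefmx A -> posdefmx B ->
  0 <= p <= 1 -> lemx A B -> lemx (rpow A p) (rpow B p).
Proof.
move=> hA hB hp leAB; move: p hp; apply: dyadic_closure.
- by rewrite !rpow0.
- by rewrite !rpow1.
- by move=> s t; exact: lemx_rpow_midpoint.
- by move=> p; exact: Nlemx_rpow_open.
Qed.

End LoewnerHeinzTheorem.

(** * The largest singular value *)

Section GeometricMean.
Context {R : realType}.
Local Notation C := R[i].

Definition gmean n t (A B : 'M[C]_n) : 'M[C]_n :=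
  rpow A 2^-1 *m rpow (rpow A (- 2^-1) *m B *m rpow A (- 2^-1)) t
    *m rpow A 2^-1.

Lemma geomeanE n t (A B : 'M[C]_n) : geomean t A B = gmean t A B.
Proof. by rewrite /geomean !rpowE. Qed.

Lemma lemx_rpow_congr n (A X Y : 'M[C]_n) s : posdefmx A -> lemx X Y ->
  lemx (rpow A s *m X *m rpow A s) (rpow A s *m Y *m rpow A s).
Proof.
by move=> hA XY; have := lemx_congr (rpow A s) XY; rewrite (adjmx_rpow s hA).
Qed.

Lemma posdef_rpow_congr n (A B : 'M[C]_n) s : posdefmx A -> posdefmx B ->
  posdefmx (rpow A s *m B *m rpow A s).
Proof.
move=> hA hB; have := posdef_congr hB (rpow_unit s hA).
by rewrite adjmx_rpow.
Qed.

Lemma posdef_gmean n t (A B : 'M[C]_n) : posdefmx A -> posdefmx B ->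
  posdefmx (gmean t A B).
Proof.
move=> hA hB; have hP := posdef_rpow t (posdef_rpow_congr (- 2^-1) hA hB).
exact: posdef_rpow_congr hA hP.
Qed.

Lemma posdef_invE n (A B : 'M[C]_n) : posdefmx A -> A *m B = 1%:M ->
  B = rpow A (-1).
Proof.
move=> hA AB; have := rpowV (-1) hA; rewrite opprK rpow1 // => VA.
by rewrite -[B]mul1mx -VA -mulmxA AB mulmx1.
Qed.

(* With Z = A^(-1/2) B^(1/2), intertwining Z Z^t* and Z^t* Z moves the power t
   from the first to the second. *)
Lemma gmean_swap n t (A B : 'M[C]_n) : posdefmx A -> posdefmx B ->
  gmean t A B = gmean (1 - t) B A.
Proof.
move=> hA hB; rewrite /gmean.
set P := _ *m B *m _; set S := _ *m A *m _.
have hP : posdefmx P := posdef_rpow_congr (- 2^-1) hA hB.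
have hS : posdefmx S := posdef_rpow_congr (- 2^-1) hB hA.
pose Q := rpow B 2^-1 *m rpow A (-1) *m rpow B 2^-1.
have hQ : posdefmx Q := posdef_rpow_congr 2^-1 hB (posdef_rpow (-1) hA).
pose Z := rpow A (- 2^-1) *m rpow B 2^-1.
have BE : rpow B 2^-1 *m rpow B 2^-1 = B.
  by rewrite (rpowD (u := 1) hB) ?rpow1 //; lra.
have AE : rpow A 2^-1 *m rpow A 2^-1 = A.
  by rewrite (rpowD (u := 1) hA) ?rpow1 //; lra.
have AVE : rpow A (- 2^-1) *m rpow A (- 2^-1) = rpow A (-1).
  by rewrite (rpowD (u := -1) hA) //; lra.
have AN : rpow A 2^-1 *m rpow A (- 2^-1) = 1%:M by rewrite rpowV.
have AN' : rpow A (- 2^-1) *m rpow A 2^-1 = 1%:M by exact: mulmx1C.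
have BN : rpow B 2^-1 *m rpow B (- 2^-1) = 1%:M by rewrite rpowV.
have BN' : rpow B (- 2^-1) *m rpow B 2^-1 = 1%:M by exact: mulmx1C.
have AA : A *m rpow A (-1) = 1%:M by rewrite -{1}(rpow1 hA) rpowV.
have PZ : P *m Z = Z *m Q.
  rewrite /P /Z /Q !mulmxA -(mulmxA _ (rpow A _) (rpow A _)) AVE.
  by rewrite -(mulmxA _ (rpow B _) (rpow B _)) BE.
have SQ : S *m Q = 1%:M.
  rewrite /S /Q !mulmxA -(mulmxA _ (rpow B _) (rpow B _)) BN' mulmx1.
  by rewrite -(mulmxA _ A) AA mulmx1.
have AZ : rpow A 2^-1 = Z *m rpow B (- 2^-1) *m A.
  by rewrite /Z -(mulmxA _ (rpow B 2^-1)) BN mulmx1 -{3}AE mulmxA AN' mul1mx.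
have AB : rpow B (- 2^-1) *m A = S *m rpow B 2^-1.
  by rewrite /S -(mulmxA _ (rpow B _)) BN' mulmx1.
have ZB : rpow A 2^-1 *m Z = rpow B 2^-1 by rewrite /Z mulmxA AN mul1mx.
clearbody P S Q Z.
rewrite [X in _ *m X = _]AZ -(mulmxA Z) AB !mulmxA -(mulmxA _ _ Z).
rewrite (rpow_intertwine t hP hQ PZ) !mulmxA ZB -(mulmxA _ _ S).
congr (_ *m _ *m _).
(* Here Q is the inverse of S, so Q^t S = S^(1-t): this is the origin of the weight 1 - t. *)
rewrite (posdef_invE hS SQ) rpowM // -[X in _ *m X](rpow1 hS).
by rewrite (rpowD (u := 1 - t) hS) //; lra.
Qed.

Lemma scalar_lemx_rpow n (A B : 'M[C]_n) c p : posdefmx A -> posdefmx B ->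
  0 < c -> 0 <= p <= 1 ->
  lemx B (c%:C *: A) -> lemx (rpow B p) ((c `^ p)%:C *: rpow A p).
Proof.
move=> hA hB c0 p01 leBA; rewrite -(rpowZ _ hA c0).
exact: Loewner_Heinz hB (posdefZ hA c0) p01 leBA.
Qed.

(** Conjugation by A^(-1/2) gives the bound c A^(-2) on the middle factor of the mean, Loewner-Heinz
    turns it into c^t A^(-2t), and conjugation by A^(1/2) gives the result. *)
Lemma lemx_gmean n t c (A B : 'M[C]_n) : posdefmx A -> posdefmx B ->
  0 < c -> 0 <= t <= 1 -> lemx B (c%:C *: rpow A (-1)) ->
  lemx (gmean t A B) ((c `^ t)%:C *: rpow A (1 - 2 * t)).
Proof.
move=> hA hB c0 t01 leBA.
have hP := posdef_rpow_congr (- 2^-1) hA hB.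
have h2 := posdef_rpow (-2) hA.
have leP : lemx (rpow A (- 2^-1) *m B *m rpow A (- 2^-1)) (c%:C *: rpow A (-2)).
  have := lemx_rpow_congr (- 2^-1) hA leBA.
  rewrite -scalemxAr -scalemxAl (rpowD (u := - (3 / 2)) hA); last by lra.
  by rewrite (rpowD (u := -2) hA); [exact|lra].
have := scalar_lemx_rpow h2 hP c0 t01 leP; rewrite (rpowM _ _ hA) => lePt.
have := lemx_rpow_congr 2^-1 hA lePt.
rewrite -scalemxAr -scalemxAl (rpowD (u := 2^-1 - 2 * t) hA); last by lra.
by rewrite (rpowD (u := 1 - 2 * t) hA); [exact|lra].
Qed.

(** A scalar bound is a bound on the eigenvalues, and these are positive, so it survives
    squaring. *)
Lemma lemx_sqr n (K : 'M[C]_n) a : posdefmx K -> 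
  lemx K a%:C%:M -> lemx (K *m K) (a ^+ 2)%:C%:M.
Proof.
move=> /posdef_specP [U [d [Uu d0 ->]]] /(lemx_specmxP _ _ Uu) da.
rewrite (specmxM _ _ Uu); apply/(lemx_specmxP _ _ Uu) => j.
by rewrite expr2 ler_pM // ltW.
Qed.

Definition mean_mx n (A B : 'M[C]_n) t :=
  rpow A (t - 2^-1) *m gmean t A B *m rpow B (2^-1 - t).

(** The symmetry that reduces t >= 1/2 to t <= 1/2. *)
Lemma adjmx_mean_mx n (A B : 'M[C]_n) t : posdefmx A -> posdefmx B ->
  (mean_mx A B t)^t* = mean_mx B A (1 - t).
Proof.
move=> hA hB; rewrite /mean_mx 2!adjmxM (adjmx_rpow _ hA) (adjmx_rpow _ hB).
rewrite (posdef_adj (posdef_gmean t hA hB)) (gmean_swap _ hA hB) mulmxA.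
by congr (rpow _ _ *m _ *m rpow _ _); lra.
Qed.

Lemma mean_mx_le_half n (A B : 'M[C]_n) c t : posdefmx A -> posdefmx B ->
  0 < c -> 0 <= t <= 2^-1 ->
  lemx (rpow A 2^-1 *m B *m rpow A 2^-1) c%:C%:M ->
  lemx (mean_mx A B t *m (mean_mx A B t)^t*) c%:C%:M.
Proof.
move=> hA hB c0 t01 leY; set G := gmean t A B.
have GE : G^t* = G by exact: posdef_adj (posdef_gmean t hA hB).
have leB : lemx B (c%:C *: rpow A (-1)).
  have := lemx_rpow_congr (- 2^-1) hA leY.
  rewrite !mulmxA (rpowD (u := 0) hA); last by lra.
  rewrite (rpow0 hA) mul1mx (mulmx_rpowD _ (u := 0) hA); last by lra.
  rewrite (rpow0 hA) mulmx1 mul_mx_scalar -scalemxAl.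
  by rewrite (rpowD (u := -1) hA); [exact|lra].
have leB2 : lemx (rpow B (1 - 2 * t))
                 ((c `^ (1 - 2 * t))%:C *: rpow A (2 * t - 1)).
  have hA1 := posdef_rpow (-1) hA.
  have h : 0 <= 1 - 2 * t <= 1 by lra.
  have := scalar_lemx_rpow hA1 hB c0 h leB; rewrite (rpowM _ _ hA).
  by rewrite (_ : -1 * (1 - 2 * t) = 2 * t - 1); [exact|lra].
(* The exponent t - 1/2 on both sides cancels the A^(1-2t) in the bound on G, and A^(2t-1) in the
   bound on B^(1-2t) supplies the two inner factors of [K *m K]. *)
pose K := rpow A (t - 2^-1) *m G *m rpow A (t - 2^-1).
have hK : posdefmx K := posdef_rpow_congr (t - 2^-1) hA (posdef_gmean t hA hB).
have leK : lemx K (c `^ t)%:C%:M.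
  have h : 0 <= t <= 1 by lra.
  have := lemx_rpow_congr (t - 2^-1) hA (lemx_gmean hA hB c0 h leB).
  rewrite -scalemxAr -scalemxAl.
  rewrite (rpowD (u := 2^-1 - t) hA); last by lra.
  rewrite (rpowD (u := 0) hA) ?(rpow0 hA) ?scalemx1; [exact|lra].
have hG : posdefmx G := posdef_gmean t hA hB.
have := lemx_congr (G *m rpow A (t - 2^-1)) leB2.
rewrite adjmxM GE (adjmx_rpow _ hA) -scalemxAr -scalemxAl => leX.
have assocX (X Y Z W G' : 'M[C]_n) :
    X *m G' *m Y *m (Z *m (G' *m W)) = X *m G' *m (Y *m Z) *m (G' *m W).
  by rewrite !mulmxA.
have assocK (X Y Z W G' : 'M[C]_n) :
    X *m G' *m Y *m (Z *m G' *m W) = X *m G' *m (Y *m Z) *m (G' *m W).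
  by rewrite !mulmxA.
have XE : mean_mx A B t *m (mean_mx A B t)^t* =
    rpow A (t - 2^-1) *m G *m rpow B (1 - 2 * t) *m (G *m rpow A (t - 2^-1)).
  rewrite /mean_mx -/G 2!adjmxM GE (adjmx_rpow _ hA) (adjmx_rpow _ hB) assocX.
  by congr (_ *m _ *m _); rewrite (rpowD (u := 1 - 2 * t) hB) //; lra.
have KE : K *m K =
    rpow A (t - 2^-1) *m G *m rpow A (2 * t - 1) *m (G *m rpow A (t - 2^-1)).
  rewrite /K assocK.
  by congr (_ *m _ *m _); rewrite (rpowD (u := 2 * t - 1) hA) //; lra.
rewrite -KE -XE in leX; apply: lemx_trans leX _.
have cE : c = c `^ (1 - 2 * t) * (c `^ t) ^+ 2.
  have cn0 : c != 0 by rewrite gt_eqF.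
  rewrite expr2 -(powRD (r := t)) ?cn0 ?implybT //.
  rewrite -(powRD (r := 1 - 2 * t)) ?cn0 ?implybT //.
  rewrite (_ : 1 - 2 * t + (t + t) = 1); last by lra.
  by rewrite powRr1 // ltW.
rewrite [X in X%:C%:M]cE rmorphM -scale_scalar_mx.
by apply: lemxZ (lemx_sqr hK leK); rewrite powR_ge0.
Qed.

(** Being available for every c > 0, this says that the largest singular value does not increase. *)
Lemma mean_mx_le n (A B : 'M[C]_n) c t : posdefmx A -> posdefmx B ->
  0 < c -> 0 <= t <= 1 ->
  lemx ((rpow A 2^-1 *m rpow B 2^-1)^t* *m (rpow A 2^-1 *m rpow B 2^-1)) c%:C%:M ->
  lemx ((mean_mx A B t)^t* *m mean_mx A B t) c%:C%:M.
Proof.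
move=> hA hB c0 t01; rewrite adjmxM (adjmx_rpow _ hA) (adjmx_rpow _ hB) => leY.
have AE : rpow A 2^-1 *m rpow A 2^-1 = A.
  by rewrite (rpowD (u := 1) hA) ?rpow1 //; lra.
have BE : rpow B 2^-1 *m rpow B 2^-1 = B.
  by rewrite (rpowD (u := 1) hB) ?rpow1 //; lra.
have [t2|/ltW t2] := leP t 2^-1.
  have := lemx_gram_flip (X := (mean_mx A B t)^t*) c0; rewrite trmxCK; apply.
  (* In this case both Gram matrices have to be flipped, since the half-range bound is about X X^*
     and A^(1/2) B A^(1/2). In the other case, taking adjoints already puts both in the required
     order. *)
  have h : 0 <= t <= 2^-1 by lra.
  apply: (mean_mx_le_half hA hB c0 h).
  have := lemx_gram_flip (X := rpow A 2^-1 *m rpow B 2^-1) c0.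
  rewrite adjmxM (adjmx_rpow _ hA) (adjmx_rpow _ hB) => /(_ leY).
  by rewrite !mulmxA -(mulmxA _ (rpow B _) (rpow B _)) BE.
have h : 0 <= 1 - t <= 2^-1 by lra.
rewrite -{2}[mean_mx A B t]trmxCK (adjmx_mean_mx _ hA hB).
apply: (mean_mx_le_half hB hA c0 h).
by move: leY; rewrite !mulmxA -(mulmxA _ (rpow A _) (rpow A _)) AE.
Qed.

End GeometricMean.

(** * Compound matrices *)

Section CauchyBinet.
Context {F : comNzRingType}.

Definition ksub (k m : nat) := {S : {set 'I_m} | #|S| == k}.

Definition kfun k m (S : ksub k m) (i : 'I_k) : 'I_m :=
  enum_val (cast_ord (esym (eqP (valP S))) i).

Lemma kfun_inj k m (S : ksub k m) : injective (kfun S).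
Proof. by move=> i j /enum_val_inj /cast_ord_inj. Qed.

Lemma mem_kfun k m (S : ksub k m) i : kfun S i \in val S.
Proof. exact: enum_valP. Qed.

Lemma kfunP k m (S : ksub k m) x : x \in val S -> exists i, kfun S i = x.
Proof.
move=> xS; exists (cast_ord (eqP (valP S)) (enum_rank_in xS x)).
by rewrite /kfun cast_ordK enum_rankK_in.
Qed.

Lemma prod_kfun k m (S : ksub k m) (d : 'I_m -> F) :
  \prod_i d (kfun S i) = \prod_(x in val S) d x.
Proof.
have -> : val S = [set kfun S i | i in 'I_k].
  apply/setP => x; apply/idP/imsetP => [/kfunP [i <-]|[i _ ->]].
    by exists i.
  exact: mem_kfun.
by rewrite big_imset //= => i j _ _; exact: kfun_inj.
Qed.

(** Multilinearity in the rows: [f i] is the row of B selected in expanding row i of the product. *)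
Lemma det_mul_ffun k m (A : 'M[F]_(k, m)) (B : 'M[F]_(m, k)) :
  \det (A *m B) =
  \sum_(f : {ffun 'I_k -> 'I_m}) (\prod_i A i (f i)) * \det (rowsub f B).
Proof.
pose AB (s : 'S_k) i j := A i j * B j (s i).
transitivity (\sum_(f : {ffun 'I_k -> 'I_m}) \sum_(s : 'S_k)
    (-1) ^+ s * \prod_i AB s i (f i)).
  rewrite exchange_big; apply: eq_bigr => /= s _; rewrite -big_distrr /=.
  congr (_ * _); rewrite -(bigA_distr_bigA (AB s)) /=.
  by apply: eq_bigr => x _; rewrite mxE.
apply: eq_bigr => f _; rewrite big_distrr /=; apply: eq_bigr => s _.
rewrite mulrCA big_split //=; congr (_ * (_ * _)).
by apply: eq_bigr => x _; rewrite mxE.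
Qed.

(** Encodes an injective map by its image and a permutation; [kperm_inj] and [mem_kperm] show that
    each injective map arises exactly once. *)
Definition kperm k m (p : ksub k m * 'S_k) : {ffun 'I_k -> 'I_m} :=
  [ffun i => kfun p.1 (p.2 i)].

Lemma kperm_inj k m : injective (@kperm k m).
Proof.
have sub (S S' : ksub k m) s s' : kperm (S, s) = kperm (S', s') ->
    val S \subset val S'.
  move=> /ffunP SS; apply/subsetP => x /kfunP [i <-].
  by have := SS ((s^-1)%g i); rewrite !ffunE /= permKV => ->; exact: mem_kfun.
move=> [S s] [S' s'] SS; have ES : S = S'.
  apply: val_inj; apply/eqP; rewrite eqEcard (sub _ _ _ _ SS).
  by rewrite (eqP (valP S)) (eqP (valP S')) leqnn.
subst S'; congr pair; apply/permP => i; apply: (@kfun_inj _ _ S).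
by have /ffunP/(_ i) := SS; rewrite !ffunE.
Qed.

Lemma mem_kperm k m (f : {ffun 'I_k -> 'I_m}) :
  (f \in [set kperm p | p in [set: ksub k m * 'S_k]]) = injectiveb f.
Proof.
apply/imsetP/injectiveP => [[[S s] _ ->] i j|finj].
  by rewrite !ffunE /= => /kfun_inj /perm_inj.
have Sk : #|[set f i | i in 'I_k]| == k by rewrite card_imset // card_ord.
pose S : ksub k m := Sub [set f i | i in 'I_k] Sk.
have fS i : exists j, kfun S j == f i.
  have [|j <-] := @kfunP _ _ S (f i); first exact: imset_f.
  by exists j.
pose g i := xchoose (fS i).
have gE i : kfun S (g i) = f i by exact/eqP/(xchooseP (fS i)).
have ginj : injective g by move=> i j gij; apply: finj; rewrite -!gE gij.
exists (S, perm ginj); rewrite ?inE //.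
by apply/ffunP => i; rewrite ffunE /= permE gE.
Qed.

(** Non-injective selections repeat a row and vanish. Injective ones are grouped by image, and the
    signs from reordering the rows of B rebuild the minor of A. *)
Lemma Cauchy_Binet k m (A : 'M[F]_(k, m)) (B : 'M[F]_(m, k)) :
  \det (A *m B) =
  \sum_(S : ksub k m) \det (colsub (kfun S) A) * \det (rowsub (kfun S) B).
Proof.
rewrite det_mul_ffun (bigID (fun f : {ffun 'I_k -> 'I_m} => injectiveb f)) /=.
rewrite [X in _ + X]big1 ?addr0 => [|f Uf]; last first.
  case/injectivePn: Uf => i1 [i2 Di12 Ef12].
  by rewrite (determinant_alternate Di12) ?mulr0 // => j; rewrite !mxE Ef12.
under eq_bigl do rewrite -mem_kperm.
rewrite big_imset /=; last by move=> p q _ _; exact: kperm_inj.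
rewrite (eq_bigl predT) => [|p]; last by rewrite inE.
rewrite -(pair_bigA _ (fun S s => (\prod_i A i (kperm (S, s) i)) *
   \det (rowsub (kperm (S, s)) B))) /=.
apply: eq_bigr => S _; rewrite big_distrl /=; apply: eq_bigr => s _.
have -> : rowsub (kperm (S, s)) B = row_perm s (rowsub (kfun S) B).
  by apply/matrixP => i j; rewrite !mxE ffunE.
rewrite row_permE det_mulmx det_perm mulrA [_ * (-1) ^+ s]mulrC.
by congr (_ * _ * _); apply: eq_bigr => i _; rewrite !mxE ffunE.
Qed.

End CauchyBinet.

Section Compound.
Context {F : comNzRingType}.

Definition ksub_of k m (a : 'I_#|{: ksub k m}|) : ksub k m := enum_val a.

(** The matrix of the k-th exterior power; k-subsets are numbered by ordinals in order to index a
    matrix. *)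
Definition compound k m (A : 'M[F]_m) : 'M[F]_#|{: ksub k m}| :=
  \matrix_(a, b) \det (mxsub (kfun (ksub_of a)) (kfun (ksub_of b)) A).

Lemma compoundM k m (A B : 'M[F]_m) :
  compound k (A *m B) = compound k A *m compound k B.
Proof.
apply/matrixP => a b; rewrite !mxE mxsub_mul Cauchy_Binet.
rewrite (reindex (@ksub_of k m)) /=; last exact: onW_bij (enum_val_bij _).
apply: eq_bigr => c _; rewrite !mxE -[colsub _ _]mxsub_comp.
by congr (\det _ * \det _); apply/matrixP => i j; rewrite !mxE.
Qed.

Lemma compound_tr k m (A : 'M[F]_m) : compound k A^T = (compound k A)^T.
Proof.
apply/matrixP => a b; rewrite !mxE -det_tr; congr (\det _).
by apply/matrixP => i j; rewrite !mxE.
Qed.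

Lemma compound_diag k m (d : 'I_m -> F) :
  compound k (diag_mx (\row_j d j)) =
  diag_mx (\row_a \prod_(x in val (ksub_of a)) d x) :> 'M_#|{: ksub k m}|.
Proof.
apply/matrixP => a b; rewrite !mxE; have [<-|ab] := eqVneq a b.
  rewrite mulr1n -prod_kfun.
  set M := mxsub _ _ _.
  have -> : M = diag_mx (\row_i d (kfun (ksub_of a) i)).
    by apply/matrixP => i j; rewrite !mxE (inj_eq (@kfun_inj _ _ _)).
  by rewrite det_diag; apply: eq_bigr => i _; rewrite !mxE.
(* Distinct sets of equal size: a point of the first outside the second gives the minor a zero
   row. *)
have : ~~ (val (ksub_of a) \subset val (ksub_of b)).
  apply: contra ab => ab; apply/eqP/enum_val_inj/val_inj/eqP.
  by rewrite eqEcard ab (eqP (valP (ksub_of a))) (eqP (valP (ksub_of b))) leqnn.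
move=> /subsetPn [x /kfunP [i <-] xb].
rewrite (expand_det_row _ i) mulr0n big1 // => j _.
rewrite !mxE (_ : (_ == _) = false) ?mulr0n ?mul0r //.
by apply: contraNF xb => /eqP ->; exact: mem_kfun.
Qed.

Lemma compound1 k m : compound k 1%:M = 1%:M :> 'M_#|{: ksub k m}|.
Proof.
have one n : 1%:M = diag_mx (\row_(j < n) 1) :> 'M[F]_n.
  by apply/matrixP => i j; rewrite !mxE.
rewrite one compound_diag one; congr diag_mx; apply/rowP => a.
by rewrite !mxE big1.
Qed.

End Compound.

Lemma compound_map (F F' : comNzRingType) (f : {rmorphism F -> F'}) k m
    (A : 'M[F]_m) : compound k (map_mx f A) = map_mx f (compound k A).
Proof.
apply/matrixP => a b; rewrite !mxE -det_map_mx; congr (\det _).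
by apply/matrixP => i j; rewrite !mxE.
Qed.
Section CompoundSpectral.
Context {R : realType}.
Local Notation C := R[i].

Lemma compound_adj k m (A : 'M[C]_m) : compound k (A^t*) = (compound k A)^t*.
Proof. by rewrite compound_map compound_tr. Qed.

Lemma compound_unitary k m (U : 'M[C]_m) :
  U \is unitarymx -> compound k U \is unitarymx.
Proof.
move=> /unitarymxP Uu; apply/unitarymxP.
by rewrite -compound_adj -compoundM Uu compound1.
Qed.

Definition kprod k m (d : 'I_m -> R) (a : 'I_#|{: ksub k m}|) : R :=
  \prod_(x in val (ksub_of a)) d x.

(** By multiplicativity a diagonalization passes to the compound, so the eigenvalues there are the
    k-fold products over k-subsets. *)
Lemma compound_specmx k m (U : 'M[C]_m) d :
  compound k (specmx U d) = specmx (compound k U) (kprod d).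
Proof.
rewrite {2}/specmx.
have -> : rdiag (kprod d) = compound k (rdiag d).
  rewrite /rdiag compound_diag; congr diag_mx.
  by apply/rowP => a; rewrite !mxE rmorph_prod.
by rewrite -compound_adj -2!compoundM.
Qed.

Lemma kprod_gt0 k m (d : 'I_m -> R) (a : 'I_#|{: ksub k m}|) :
  (forall j, 0 < d j) -> 0 < kprod d a.
Proof. by move=> d0; apply: prodr_gt0. Qed.

Lemma posdef_compound k m (A : 'M[C]_m) :
  posdefmx A -> posdefmx (compound k A).
Proof.
move=> /posdef_specP [U [d [Uu d0 ->]]]; rewrite compound_specmx.
apply: posdef_specmx => [|a]; first exact: compound_unitary.
exact: kprod_gt0.
Qed.

Lemma compound_rpow k m (A : 'M[C]_m) t : posdefmx A ->
  compound k (rpow A t) = rpow (compound k A) t.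
Proof.
move=> /posdef_specP [U [d [Uu d0 ->]]].
rewrite (rpow_specmx _ _ Uu) !compound_specmx.
rewrite (rpow_specmx _ _ (compound_unitary k Uu)).
apply: eq_specmx => a; rewrite /kprod powR_prod // => j _.
exact: ltW.
Qed.

Lemma compound_gmean k m t (A B : 'M[C]_m) : posdefmx A -> posdefmx B ->
  compound k (gmean t A B) = gmean t (compound k A) (compound k B).
Proof.
move=> hA hB; rewrite /gmean 2!compoundM (compound_rpow _ _ hA).
rewrite (compound_rpow _ _ (posdef_rpow_congr (- 2^-1) hA hB)) 2!compoundM.
by rewrite (compound_rpow _ _ hA).
Qed.

Lemma compound_mean_mx k m t (A B : 'M[C]_m) : posdefmx A -> posdefmx B ->
  compound k (mean_mx A B t) = mean_mx (compound k A) (compound k B) t.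
Proof.
move=> hA hB; rewrite /mean_mx 2!compoundM (compound_gmean _ _ hA hB).
by rewrite (compound_rpow _ _ hA) (compound_rpow _ _ hB).
Qed.

Lemma posdef_det n (A : 'M[C]_n) : posdefmx A ->
  exists2 a : R, 0 < a & forall t, \det (rpow A t) = (a `^ t)%:C.
Proof.
move=> hA; exists (complex.Re (\det A)); last by move=> t; exact: det_rpow.
case/posdef_specP: hA => [U [d [Uu d0 ->]]].
by rewrite (det_specmx _ Uu) /=; apply: prodr_gt0.
Qed.

(** With a = det A and b = det B, the middle factor of the mean has determinant b/a raised to t, and
    a^(t+1/2) (b/a)^t b^(1/2-t) = (ab)^(1/2). *)
Lemma det_mean_mx n t (A B : 'M[C]_n) : posdefmx A -> posdefmx B ->
  \det (mean_mx A B t) = \det (rpow A 2^-1 *m rpow B 2^-1).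
Proof.
move=> hA hB.
have [a a0 detA] := posdef_det hA; have [b b0 detB] := posdef_det hB.
have hP := posdef_rpow_congr (- 2^-1) hA hB.
have [p p0 detP] := posdef_det hP.
have pE : p = a `^ (- 2^-1) * b * a `^ (- 2^-1).
  apply: complexI; rewrite -[p](powRr1 (ltW p0)) -detP (rpow1 hP) !det_mulmx.
  by rewrite detA -{1}(rpow1 hB) detB (powRr1 (ltW b0)) -!rmorphM.
rewrite /mean_mx /gmean !det_mulmx !detA !detB detP -!rmorphM pE.
congr (_%:C); clear -a0 b0.
(* In logarithms the identity between powers becomes one between exponents, within reach of
   [field]. *)
rewrite -[a](@lnK R) ?posrE // -[b](@lnK R) ?posrE //.
move: (ln a) (ln b) => x y.
have powE u v : expR u `^ v = expR (u * v).
  by rewrite /powR gt_eqF ?expR_gt0 // expRK mulrC.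
by rewrite !powE -!expRD powE -!expRD; congr expR; field.
Qed.

End CompoundSpectral.

(** * Products of the largest singular values *)

Section SingularValues.
Context {R : realType}.
Local Notation C := R[i].

Definition sval_eig m (X : 'M[C]_m) : 'I_m -> R :=
  eigenval (mxpow (X^t* *m X) 2^-1).

(** The values are read from a diagonalization of the square root S, chosen independently of that of
    the Gram matrix. Applying the same function to both diagonalizations of S transfers the facts:
    the absolute value gives the signs, the square gives the Gram matrix. *)
Lemma sval_eigP m (X : 'M[C]_m) : exists2 U, U \is unitarymx &
  (forall j, 0 <= sval_eig X j) /\
  X^t* *m X = specmx U (fun j => sval_eig X j ^+ 2).
Proof.
set G := X^t* *m X.
have hG : G \is hermsymmx by apply/hermsymmxP; rewrite /G adjmxM trmxCK.
pose V := spectralmx G; pose d := eigenval G.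
have Vu : V \is unitarymx := spectral_unitarymx G.
have GE : G = specmx V d := herm_specmxE hG.
have d0 j : 0 <= d j.
  have := qform1_ge0 (X *m (V^t* *m delta_mx j 0)).
  by rewrite -qform_congr mulmx1 -/G GE qform_specmx_basis // (lecR 0).
pose S := mxpow G 2^-1.
have SE : S = specmx V (fun j => d j `^ 2^-1).
  by rewrite /S {1}GE; exact: herm_fun_specmx.
have hS : S \is hermsymmx by rewrite SE specmx_hermsymmx.
pose U := spectralmx S; have Uu : U \is unitarymx := spectral_unitarymx S.
have SE' : specmx U (sval_eig X) = specmx V (fun j => d j `^ 2^-1).
  by rewrite -SE [RHS](herm_specmxE hS).
exists U => //; split=> [j|].
  have := specmx_inj (fun x => `|x|) Uu Vu SE'.
  rewrite [RHS](eq_specmx V (e := fun j => d j `^ 2^-1)); last first.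
    by move=> i /=; rewrite ger0_norm // powR_ge0.
  rewrite -SE' => /(congr1 (fun M => qform M (U^t* *m delta_mx j 0))).
  rewrite !(qform_specmx_basis _ _ Uu) => /complexI /= <-.
  exact: normr_ge0.
have := specmx_inj (fun x => x ^+ 2) Uu Vu SE' => /= UV.
rewrite -[RHS]/(specmx U ((fun x => x ^+ 2) \o sval_eig X)) UV GE.
apply: eq_specmx => j /=.
by rewrite powR12_sqrt ?sqr_sqrtr.
Qed.

Lemma lemx_compound_gram k m (X : 'M[C]_m) c :
  lemx ((compound k X)^t* *m compound k X) c%:C%:M <->
  forall a : 'I_#|{: ksub k m}|, kprod (sval_eig X) a ^+ 2 <= c.
Proof.
have [U Uu [_ XE]] := sval_eigP X.
rewrite -compound_adj -compoundM XE compound_specmx.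
rewrite (lemx_specmxP _ _ (compound_unitary k Uu)).
by split=> le a; have := le a; rewrite /kprod prodrXl.
Qed.

Lemma det_gram_sval m (X : 'M[C]_m) :
  \det (X^t* *m X) = ((\prod_j sval_eig X j) ^+ 2)%:C.
Proof.
have [U Uu [_ ->]] := sval_eigP X.
by rewrite (det_specmx _ Uu) prodrXl.
Qed.

End SingularValues.

Section TopProduct.
Context {R : realType}.

(** Exchange argument: T and the initial segment K differ by parts of equal size, and one value of y
    separates the values on these parts. *)
Lemma prod_le_initial m (y : 'I_m -> R) k (T : {set 'I_m}) :
  (forall i, 0 <= y i) -> (forall i j : 'I_m, (i <= j)%N -> y j <= y i) ->
  #|T| = k -> \prod_(i in T) y i <= \prod_(i < m | (i < k)%N) y i.
Proof.
move=> y0 ymono Tk.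
have [km|mk] := leqP k m; last first.
  by have := max_card (mem T); rewrite Tk card_ord leqNgt mk.
case: k => [|k] in Tk km *.
  by rewrite (cards0_eq Tk) big_set0 big1.
pose K := [set i : 'I_m | (i < k.+1)%N].
have Kk : #|K| = k.+1.
  rewrite cardsE -sum1_card.
  by rewrite -(big_ord_widen_cond m predT (fun=> 1%N) km) sum1_card card_ord.
have eqD : #|T :\: K| = #|K :\: T|.
  by apply: (@addnI #|T :&: K|); rewrite cardsID Tk setIC cardsID Kk.
rewrite [leRHS](_ : _ = \prod_(i in K) y i); last first.
  by apply: eq_bigl => i; rewrite inE.
rewrite (big_setID K) (big_setID (A := K) T) /= setIC.
apply: ler_wpM2l; first by apply: prodr_ge0 => i _; exact: y0.
(* After the case on k the segment has k+1 elements, so index k is its last one. *)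
pose p := y (Ordinal km).
apply: (@le_trans _ _ (p ^+ #|T :\: K|)).
  rewrite -prodr_const ler_prod // => i; rewrite !inE -leqNgt => /andP[ki _].
  by rewrite y0 ymono //= ltnW.
rewrite eqD -prodr_const ler_prod // => i; rewrite !inE => /andP[_ ik].
by rewrite y0 ymono.
Qed.

(** Needed because the statement sorts twice, in [singular_values] and in [log_majorized]. *)
Lemma decr_idem m (x : m.-tuple R) : decr (decr x) = decr x.
Proof.
apply: val_inj => /=; apply: sorted_sort; first exact: ge_trans.
exact: (sort_sorted ge_total).
Qed.

Lemma decr_perm m (x : m.-tuple R) :
  exists s : 'S_m, forall i : 'I_m, (decr x)`_i = tnth x (s i).
Proof.
have /tuple_permP [s sE] : perm_eq (decr x) x by rewrite /= perm_sort.
exists s => i; rewrite sE (nth_map i) ?size_enum_ord // nth_ord_enum //.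
Qed.

Lemma decr_mono m (x : m.-tuple R) (i j : 'I_m) :
  (i <= j)%N -> (decr x)`_j <= (decr x)`_i.
Proof.
move=> ij; have := sorted_leq_nth ge_trans ge_refl 0 (sort_sorted ge_total x).
by apply; rewrite ?inE ?size_sort ?size_tuple.
Qed.

(** For nonnegative entries and k <= m this is the maximum of the products over k-subsets, by
    [top_prod_ge] and [top_prod_attained]; that is how it meets the eigenvalues of a compound. *)
Definition top_prod m (x : m.-tuple R) k : R := \prod_(i < k) (decr x)`_i.

Lemma top_prod_ge m (x : m.-tuple R) k (S : {set 'I_m}) :
  (forall i, 0 <= tnth x i) -> #|S| = k ->
  \prod_(i in S) tnth x i <= top_prod x k.
Proof.
move=> x0 Sk; have [s sE] := decr_perm x.
have km : (k <= m)%N by have := max_card (mem S); rewrite Sk card_ord.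
rewrite /top_prod (big_ord_widen m (fun i => (decr x)`_i) km).
pose T := [set (s^-1)%g i | i in S].
have -> : \prod_(i in S) tnth x i = \prod_(i in T) (decr x)`_i.
  rewrite big_imset /=; last by move=> i j _ _; exact: perm_inj.
  by apply: eq_bigr => i _; rewrite sE permKV.
apply: prod_le_initial => [i|i j|]; [by rewrite sE|exact: decr_mono|].
by rewrite card_imset //; exact: perm_inj.
Qed.

Lemma top_prod_attained m (x : m.-tuple R) k : (k <= m)%N ->
  exists2 S : {set 'I_m}, #|S| = k & \prod_(i in S) tnth x i = top_prod x k.
Proof.
move=> km; have [s sE] := decr_perm x.
exists [set s i | i : 'I_m in [set i : 'I_m | (i < k)%N]].
  rewrite card_imset; last exact: perm_inj.
  rewrite cardsE -sum1_card.
  by rewrite -(big_ord_widen_cond m predT (fun=> 1%N) km) sum1_card card_ord.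
rewrite big_imset /=; last by move=> i j _ _; exact: perm_inj.
rewrite /top_prod (big_ord_widen m (fun i => (decr x)`_i) km).
by apply: eq_big => i; rewrite ?inE // => _; rewrite sE.
Qed.

Lemma top_prod_full m (x : m.-tuple R) : top_prod x m = \prod_i tnth x i.
Proof.
have [s sE] := decr_perm x.
by rewrite /top_prod [RHS](reindex_perm s); apply: eq_bigr.
Qed.

End TopProduct.

Section TopSingularValues.
Context {R : realType}.
Local Notation C := R[i].

Definition sval_tuple m (X : 'M[C]_m) : m.-tuple R :=
  herm_eigenvalues (mxpow (X^t* *m X) 2^-1).

Lemma log_majorized_decr m (x y : m.-tuple R) :
  (forall k, (1 <= k <= m.-1)%N -> top_prod x k <= top_prod y k) ->
  top_prod x m = top_prod y m -> log_majorized (decr x) (decr y).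
Proof. by rewrite /log_majorized !decr_idem. Qed.

Lemma sval_eig_ge0 m (X : 'M[C]_m) j : 0 <= sval_eig X j.
Proof. by have [U _ [e0 _]] := sval_eigP X; exact: e0. Qed.

Lemma sval_eig_gt0 m (X : 'M[C]_m) j : X \in unitmx -> 0 < sval_eig X j.
Proof.
rewrite unitmxE unitfE => dX0; rewrite lt_def sval_eig_ge0 andbT.
apply: contraNneq dX0 => ej; have := det_gram_sval X.
rewrite (bigD1 j) //= ej mul0r expr0n det_mulmx => /eqP.
by rewrite mulf_eq0 => /orP[|//]; rewrite adjmx_det conjC_eq0.
Qed.

(** The hypothesis is used at the square of the top product of Y, which bounds the compound Gram
    matrix of Y and is positive because Y is invertible. The bound for X is then read at a subset
    attaining its top product. *)
Lemma top_sval_le m k (X Y : 'M[C]_m) : (k <= m)%N -> Y \in unitmx ->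
  (forall c, 0 < c ->
     lemx ((compound k Y)^t* *m compound k Y) c%:C%:M ->
     lemx ((compound k X)^t* *m compound k X) c%:C%:M) ->
  top_prod (sval_tuple X) k <= top_prod (sval_tuple Y) k.
Proof.
move=> km Yu leXY; pose c := top_prod (sval_tuple Y) k.
have c0 : 0 < c.
  have [S _ SE] := top_prod_attained (sval_tuple Y) km.
  by rewrite /c -SE; apply: prodr_gt0 => j _; exact: sval_eig_gt0.
have gramY : lemx ((compound k Y)^t* *m compound k Y) (c ^+ 2)%:C%:M.
  apply/lemx_compound_gram => a; have p0 : 0 <= kprod (sval_eig Y) a.
    by apply: prodr_ge0 => j _; exact: sval_eig_ge0.
  rewrite (ler_pXn2r (ltn0Sn 1) p0 (ltW c0)).
  apply: top_prod_ge => [j|]; first exact: sval_eig_ge0.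
  exact/eqP/(valP (ksub_of a)).
have [S /eqP Sk SE] := top_prod_attained (sval_tuple X) km.
pose a : 'I_#|{: ksub k m}| := enum_rank (Sub S Sk : ksub k m).
have := leXY _ (exprn_gt0 2 c0) gramY => /lemx_compound_gram /(_ a).
have p0 : 0 <= kprod (sval_eig X) a.
  by apply: prodr_ge0 => j _; exact: sval_eig_ge0.
have aE : kprod (sval_eig X) a = top_prod (sval_tuple X) k.
  by rewrite /kprod /ksub_of enum_rankK; exact: SE.
by rewrite (ler_pXn2r (ltn0Sn 1) p0 (ltW c0)) aE.
Qed.

(** Both products are nonnegative, with square the determinant of the Gram matrix. *)
Lemma prod_sval_eq m (X Y : 'M[C]_m) : \det X = \det Y ->
  top_prod (sval_tuple X) m = top_prod (sval_tuple Y) m.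
Proof.
move=> XY; apply: etrans (top_prod_full _) (etrans _ (esym (top_prod_full _))).
have := det_gram_sval X; rewrite det_mulmx adjmx_det XY -adjmx_det -det_mulmx.
rewrite det_gram_sval => /complexI /eqP.
have e0 (Z : 'M[C]_m) : 0 <= \prod_j sval_eig Z j.
  by apply: prodr_ge0 => j _; exact: sval_eig_ge0.
by rewrite (eqrXn2 (ltn0Sn 1) (e0 Y) (e0 X)) => /eqP YX; exact: esym YX.
Qed.

End TopSingularValues.

Theorem theorem3p3 (R : realType) (m : nat) (A B : 'M[R[i]]_m) (t : R)
    (hA : posdefmx A) (hB : posdefmx B) (ht : 0 <= t <= 1) :
  log_majorized
    (singular_values
       (mxpow A (t - 2^-1) *m geomean t A B *m mxpow B (2^-1 - t)))
    (singular_values (mxpow A 2^-1 *m mxpow B 2^-1)).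
Proof.
have -> : mxpow A (t - 2^-1) *m geomean t A B *m mxpow B (2^-1 - t) =
    mean_mx A B t by rewrite !rpowE geomeanE.
rewrite !rpowE; set X := mean_mx A B t; set Y := rpow A _ *m rpow B _.
have Yu : Y \in unitmx by rewrite unitmx_mul !rpow_unit.
apply: (@log_majorized_decr _ _ (sval_tuple X) (sval_tuple Y)) => [k /andP[_ km]|].
  apply: top_sval_le => [||c c0 leY]; [exact: leq_trans km (leq_pred m)|exact: Yu|].
  have hkA := posdef_compound k hA; have hkB := posdef_compound k hB.
  rewrite /X (compound_mean_mx _ _ hA hB).
  apply: (mean_mx_le hkA hkB c0 ht); move: leY.
  by rewrite /Y compoundM (compound_rpow _ _ hA) (compound_rpow _ _ hB).
exact: prod_sval_eq (det_mean_mx t hA hB).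
Qed.
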